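(* Let $\boldsymbol{X}=(X_1,\ldots,X_d)\sim \mathcal{N}_d(\boldsymbol{0}_d,\Sigma)$ for some positive definite $d\times d$ matrix $\Sigma$, and let $\emptyset\neq\mathcal{J}\subsetneq\{1,\ldots,d\}$ be given, with complement $\mathcal{J}^{\complement}=\{1,\ldots,d\}\setminus\mathcal{J}$. Assume that $\nu_j\in[0,1/2)$ for all $j\in\mathcal{J}$, that $\nu_i\in[0,\infty)$ for all $i\in\mathcal{J}^{\complement}$, and that $\bar\nu:=\sum_{i\in\mathcal{J}^{\complement}}\nu_i\in[1/2,\infty)$. Then $$ \mathsf{E}\left[\prod_{j\in\mathcal{J}}|X_j|^{-2\nu_j}\times\prod_{i\in\mathcal{J}^{\complement}}|X_i|^{2\nu_i}\right]\leq\mathsf{E}\left[\prod_{j\in\mathcal{J}}|X_j|^{-2\nu_j}\right]\times\mathsf{E}\left[\left(\sum_{i\in\mathcal{J}^{\complement}}\frac{\nu_i}{\bar\nu}\,|X_i|\right)^{2\bar\nu}\right]. $$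
   Context: $\mathcal{N}_d(\boldsymbol{0}_d,\Sigma)$ is the centered Gaussian law on $\mathbb{R}^d$ with covariance matrix $\Sigma$; positive definite matrices are symmetric. *)

(* Defs.v *)
From HB Require Import structures.
From mathcomp Require Import all_boot all_order all_algebra.
From mathcomp Require Import all_classical all_reals all_analysis.

Set Implicit Arguments.
Unset Strict Implicit.
Unset Printing Implicit Defensive.

Import Order.TTheory GRing.Theory Num.Theory.
Import numFieldNormedType.Exports.

Local Open Scope classical_set_scope.
Local Open Scope ring_scope.

Definition posdefmx (R : realType) (d : nat) (S : 'M[R]_d) : Prop :=
  S^T = S /\ forall v : 'cV[R]_d, v != 0 -> 0 < (v^T *m S *m v) 0 0.

Section tuple_cons.
Context {R : realType} (n : nat).

(* measurableTypeR R and R have the same Borel sets under different displays;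
   lebesgue_measure lives on the former. *)
Definition tuple_cons (p : measurableTypeR R * n.-tuple R) : n.+1.-tuple R :=
  [tuple of p.1 :: p.2].

Lemma measurable_tuple_cons :
  measurable_fun [set: measurableTypeR R * n.-tuple R] tuple_cons.
Proof. exact: measurable_cons. Qed.

Lemma measurable_tuple_uncons :
  measurable_fun [set: n.+1.-tuple R]
    (fun t => (thead t, [tuple of behead t]) : measurableTypeR R * n.-tuple R).
Proof.
apply/measurable_fun_pairP; split; first exact: measurable_tnth.
exact: measurable_behead.
Qed.

End tuple_cons.

Section lebesgue_cons.
Context {R : realType} (n : nat).
Variable mu : {sigma_finite_measure set (n.-tuple R) -> \bar R}.

Definition lebesgue_cons : set (n.+1.-tuple R) -> \bar R :=
  pushforward (@lebesgue_measure R \x mu)%E (@tuple_cons R n).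

Let lebesgue_cons0 : lebesgue_cons set0 = 0%E.
Proof. by rewrite /lebesgue_cons /pushforward preimage_set0 measure0. Qed.

Let lebesgue_cons_ge0 A : (0 <= lebesgue_cons A)%E.
Proof. by rewrite /lebesgue_cons /pushforward; exact: measure_ge0. Qed.

Let lebesgue_cons_sigma_additive : semi_sigma_additive lebesgue_cons.
Proof.
move=> F mF tF mUF; rewrite /lebesgue_cons /pushforward preimage_bigcup.
have mcons (A : set (n.+1.-tuple R)) : measurable A ->
    measurable (@tuple_cons R n @^-1` A).
  by rewrite -[X in _ -> measurable X]setTI; exact: measurable_tuple_cons.
apply: measure_semi_sigma_additive.
- by move=> k; exact: mcons.
- apply/trivIsetP => /= i j _ _ ij; rewrite -preimage_setI.
  by move/trivIsetP : tF => /(_ _ _ _ _ ij) ->//; rewrite preimage_set0.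
- by rewrite -preimage_bigcup; exact: mcons.
Qed.

HB.instance Definition _ := isMeasure.Build _ _ _ lebesgue_cons
  lebesgue_cons0 lebesgue_cons_ge0 lebesgue_cons_sigma_additive.

(* Proved by hand: for products of probability measures and of sigma-finite
   measures the library's canonical instances on _ \x _ overlap, and only the
   former are inferred. *)
Let lebesgue_cons_sigma_finite : sigma_finite setT lebesgue_cons.
Proof.
have /sigma_finiteP[F [TF ndF Foo]] := sigma_finiteT (@lebesgue_measure R).
have /sigma_finiteP[G [TG ndG Goo]] := sigma_finiteT mu.
pose g (t : n.+1.-tuple R) :
    measurableTypeR R * n.-tuple R := (thead t, [tuple of behead t]).
have gK : cancel (@tuple_cons R n) g.
  by move=> [x t]; congr (_, _); exact: val_inj.
exists (fun k => g @^-1` (F k `*` G k)).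
  rewrite -preimage_bigcup -[LHS](@preimage_setT _ _ g); congr (_ @^-1` _).
  rewrite -setXTT TF TG predeqE => -[x y]; split.
    move=> [/= [i _ Fix] [k _ Gky]]; exists (maxn i k) => //; split.
    - by move: x Fix; exact/subsetPset/ndF/leq_maxl.
    - by move: y Gky; exact/subsetPset/ndG/leq_maxr.
  by move=> [i _ []/= ? ?]; split; exists i.
move=> k; have [? ?] := Foo k; have [? ?] := Goo k; split.
  rewrite -[X in measurable X]setTI.
  by apply: measurable_tuple_uncons => //; exact: measurableX.
rewrite /lebesgue_cons /pushforward -comp_preimage.
have -> : g \o @tuple_cons R n = id by apply/funext => x; exact: gK.
by rewrite preimage_id product_measure1E// lte_mul_pinfty// ge0_fin_numE.
Qed.

HB.instance Definition _ := Measure_isSigmaFinite.Build _ _ _ lebesgue_cons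
  lebesgue_cons_sigma_finite.

End lebesgue_cons.

(* Lebesgue measure on R^n, as the n-fold product of the one on R. *)
Fixpoint lebesgue_tuple (R : realType) (n : nat) :
    {sigma_finite_measure set (n.-tuple R) -> \bar R} :=
  match n with
  | 0%N => \d_([tuple] : 0.-tuple R)
  | n'.+1 => lebesgue_cons (lebesgue_tuple R n')
  end.

Definition gaussian_pdf (R : realType) (d : nat) (S : 'M[R]_d)
    (t : d.-tuple R) : R :=
  let x : 'cV[R]_d := \col_i tnth t i in
  (Num.sqrt ((2 * pi) ^+ d * \det S))^-1
    * expR (- (x^T *m invmx S *m x) 0 0 / 2).

(* For positive definite S only: for singular S this is not the Gaussian law. *)
Definition gaussian_law (R : realType) (d : nat) (S : 'M[R]_d)
    (A : set (d.-tuple R)) : \bar R :=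
  (\int[lebesgue_tuple R d]_(t in A) (gaussian_pdf S t)%:E)%E.

Definition gaussian_vector (disp : measure_display) (T : measurableType disp)
    (R : realType) (P : probability T R) (d : nat) (S : 'M[R]_d)
    (X : {RV P >-> d.-tuple R}) : Prop :=
  forall A : set (d.-tuple R), measurable A ->
    distribution P X A = gaussian_law S A.
Arguments gaussian_vector {disp T R} P {d} S X.

(* Main.v *)
(* AM-GM bounds the left-hand side by E[f(X) g(X)] with f the product over J and
   g the 2 nubar-th power of the weighted sum, which is convex; so it suffices
   that E[f(X) g(X)] <= E[f(X)] E[g(X)].  Since |x|^(-2 nu) is, up to a constant,
   the integral over u in R of exp(- |u|^(1/nu) x^2), f is a mixture of Gaussian
   kernels exp(- sum_j s_j x_j^2), and multiplying the density by such a kernel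
   gives another Gaussian kernel with a larger precision matrix B.  The original
   law is a symmetric mixture of translates of the one with precision matrix B,
   so the mean of the convex g under the latter is at most E[g(X)]. *)
Require Import Defs.
From HB Require Import structures.
From mathcomp Require Import all_boot all_order all_algebra.
From mathcomp Require Import all_classical all_reals all_analysis.
From mathcomp Require Import measurable_realfun.
From mathcomp Require Import ring lra.

Set Implicit Arguments.
Unset Strict Implicit.
Unset Printing Implicit Defensive.

Import Order.TTheory GRing.Theory Num.Theory.
Import numFieldNormedType.Exports.

Local Open Scope ring_scope.

(** * Affine changes of variable on the line *)

Section lebesgue_affine.
Local Open Scope classical_set_scope.
Local Open Scope ereal_scope.
Context {R : realType}.
Local Notation mu := (@lebesgue_measure R).

(** Uniqueness of Lebesgue measure: [a] times the image of [mu] under [x |-> a * x + b] gives every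
    interval []u, v]] its length, hence is [mu] itself. *)
Lemma ge0_integral_affine (a b : R) (f : R -> \bar R) : (0 < a)%R ->
  measurable_fun [set: R] f -> (forall x, 0 <= f x) ->
  \int[mu]_x f x = a%:E * \int[mu]_x f (a * x + b)%R.
Proof.
move=> a0 mf f0.
pose phi (x : measurableTypeR R) : measurableTypeR R := (a * x + b)%R.
have mphi : measurable_fun [set: measurableTypeR R] phi.
  by apply: measurable_funD => //; exact: measurable_funM.
pose nu : {measure set (measurableTypeR R) -> \bar R} :=
  measure_function_pushforward__canonical__measure_function_Measure mu mphi.
transitivity (\int[mscale (NngNum (ltW a0)) nu]_x f x); last first.
  rewrite ge0_integral_mscale//=; congr (_ * _).
  by rewrite ge0_integral_pushforward// => x _; exact: f0.
apply: eq_measure_integral => A mA _.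
apply: (@lebesgue_measure_unique R
  (mscale (NngNum (ltW a0)) nu)) => // _ [[u v] _ <-] /=.
rewrite /mscale /= /pushforward.
rewrite (_ : phi @^-1` _ = `]((u - b) / a)%R, ((v - b) / a)%R]%classic); last first.
  apply/seteqP; split => x /=; rewrite !in_itv/= /phi ltr_pdivrMr// ler_pdivlMr//;
  by rewrite ltrBlDr lerBrDr ![(x * a)%R]mulrC.
rewrite !lebesgue_measure_itv/= !lte_fin ltr_pM2r ?invr_gt0// ltrD2r.
case: ifPn => _; rewrite ?mule0// -!EFinD -EFinM; congr (_%:E).
by field; rewrite gt_eqF.
Qed.

Lemma ge0_integral_opp (f : R -> \bar R) :
  measurable_fun [set: R] f -> (forall x, 0 <= f x) ->
  \int[mu]_x f (- x)%R = \int[mu]_x f x.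
Proof.
move=> mf f0; transitivity (\int[pushforward mu (-%R : _ -> measurableTypeR R)]_x f x).
  by rewrite ge0_integral_pushforward// => x _; exact: f0.
by apply: eq_measure_integral => A mA _; exact: lebesgue_measureN.
Qed.

End lebesgue_affine.

(** * Lebesgue measure on R^n: Tonelli, translations, hyperplanes *)

Section lebesgue_tuple_theory.
Local Open Scope classical_set_scope.
Local Open Scope ereal_scope.
Context {R : realType}.
Local Notation mu := (@lebesgue_measure R).

Lemma ge0_integral_lebesgue_tupleS n (f : n.+1.-tuple R -> \bar R) :
  measurable_fun setT f -> (forall t, 0 <= f t) ->
  \int[lebesgue_tuple R n.+1]_t f t =
  \int[mu]_x \int[lebesgue_tuple R n]_y f (@tuple_cons R n (x, y)).
Proof.
move=> mf f0 /=.
transitivity (\int[mu \x lebesgue_tuple R n]_p f (tuple_cons p)).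
  rewrite /lebesgue_cons ge0_integral_pushforward//.
  exact: measurable_tuple_cons.
apply: (fubini_tonelli1 (f \o @tuple_cons R n)) => /=.
  by apply: measurableT_comp => //; exact: measurable_tuple_cons.
by move=> p; exact: f0.
Qed.

Lemma tnth_tuple_cons0 n (p : measurableTypeR R * n.-tuple R) :
  tnth (tuple_cons p) ord0 = p.1.
Proof. exact: tnth0. Qed.

Lemma tnth_tuple_consS n (p : measurableTypeR R * n.-tuple R) j :
  tnth (tuple_cons p) (lift ord0 j) = tnth p.2 j.
Proof. exact: tnthS. Qed.

Lemma tnth_behead_lift n (t : n.+1.-tuple R) j :
  tnth [tuple of behead t] j = tnth t (lift ord0 j).
Proof. by case/tupleP: t => x t; rewrite tnthS !(tnth_nth 0%R). Qed.

Definition tuple_add n (x y : n.-tuple R) : n.-tuple R :=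
  [tuple (tnth x i + tnth y i)%R | i < n].

Lemma tnth_tuple_add n (x y : n.-tuple R) i :
  tnth (tuple_add x y) i = (tnth x i + tnth y i)%R.
Proof. by rewrite tnth_mktuple. Qed.

Lemma measurable_tuple_addr n (h : n.-tuple R) :
  measurable_fun setT (fun x => tuple_add x h).
Proof.
apply/measurable_fun_tnthP => i /=.
rewrite (_ : _ \o _ = fun x => (tnth x i + tnth h i)%R).
  by apply: measurable_funD => //; exact: measurable_tnth.
by apply/funext => x /=; rewrite tnth_tuple_add.
Qed.

(** Induction on the dimension: the head is translated by the affine change of variable with slope
    1, the tail by the induction hypothesis. *)
Lemma ge0_integral_tuple_add n (h : n.-tuple R) (f : n.-tuple R -> \bar R) :
  measurable_fun setT f -> (forall t, 0 <= f t) ->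
  \int[lebesgue_tuple R n]_t f (tuple_add t h) =
  \int[lebesgue_tuple R n]_t f t.
Proof.
elim: n h f => [|n IHn] h f mf f0.
  by apply: eq_integral => t _; congr f; apply: eq_from_tnth => -[].
rewrite !ge0_integral_lebesgue_tupleS//; last first.
  by apply: measurableT_comp => //; exact: measurable_tuple_addr.
pose F x := \int[lebesgue_tuple R n]_y f (tuple_cons (x, y)).
have mfc : measurable_fun setT (f \o @tuple_cons R n).
  by apply: measurableT_comp => //; exact: measurable_tuple_cons.
have mF : measurable_fun setT F.
  have := @measurable_fun_fubini_tonelli_F _ _ _ _ _ (lebesgue_tuple R n) (f \o @tuple_cons R n) mfc (fun=> f0 _); exact.
have F0 x : 0 <= F x by exact: integral_ge0.
rewrite [RHS](@ge0_integral_affine R 1 (thead h) F)// mul1e.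
apply: eq_integral => x _; rewrite mul1r /F.
rewrite -(IHn [tuple of behead h] (fun y => f (tuple_cons ((x + thead h)%R, y))))//.
  apply: eq_integral => y _; congr f; apply: eq_from_tnth => i.
  rewrite tnth_tuple_add; case: (unliftP ord0 i) => [j ->|->].
    by rewrite !tnth_tuple_consS /= tnth_tuple_add tnth_behead_lift.
  by rewrite !tnth_tuple_cons0.
exact: (measurableT_comp mfc (measurable_pair1 _)).
Qed.

(** Discards the points where a coordinate vanishes, at which the mixture formula for negative
    powers breaks down. *)
Lemma lebesgue_tuple_hyperplane n (i : 'I_n) :
  lebesgue_tuple R n [set t | tnth t i = 0%R] = 0.
Proof.
elim: n i => [[]//|n IHn] i /=; rewrite /lebesgue_cons /pushforward.
case: (unliftP ord0 i) => [j ->|->].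
  rewrite (_ : _ @^-1` _ = [set: measurableTypeR R] `*` [set t | tnth t j = 0%R]).
    rewrite product_measure1E ?IHn ?mule0//.
    rewrite (_ : [set t | _] = (@tnth n R ^~ j) @^-1` [set 0%R])// -[X in measurable X]setTI.
    by apply: measurable_tnth.
  by apply/seteqP; split => -[x y] /=; rewrite tnth_tuple_consS => // -[].
rewrite (_ : _ @^-1` _ = [set 0%R] `*` setT).
  rewrite product_measure1E; [|exact: measurable_set1|exact: measurableT].
  by rewrite [X in X * _ = _](_ : _ = 0) ?mul0e//; exact: lebesgue_measure_set1.
by apply/seteqP; split => -[x y] /=; rewrite tnth_tuple_cons0 => // -[].
Qed.

End lebesgue_tuple_theory.

(** * Quadratic forms and rank-one changes of the precision matrix *)

Section quadratic_form.
Context {R : realType} {n : nat}.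
Implicit Types (A : 'M[R]_n) (t : n.-tuple R).

Definition tuple_col t : 'cV[R]_n := \col_i tnth t i.

Definition quad A t : R := ((tuple_col t)^T *m A *m tuple_col t) 0 0.

(** Unnormalised centered Gaussian density; [A] is the precision matrix, the inverse of the
    covariance. *)
Definition gauss_kernel A t : R := expR (- quad A t / 2).

Definition tilt A (j : 'I_n) (s : R) : 'M[R]_n := A + s *: delta_mx j j.

Lemma quadE A t :
  quad A t = \sum_j (\sum_i tnth t i * A i j) * tnth t j.
Proof.
rewrite /quad mxE; apply: eq_bigr => j _; rewrite !mxE; congr (_ * _).
by apply: eq_bigr => i _; rewrite !mxE.
Qed.

Lemma measurable_quad A : measurable_fun setT (quad A).
Proof.
rewrite (_ : quad A = fun t => \sum_j (\sum_i tnth t i * A i j) * tnth t j).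
  apply: measurable_sum => j; apply: measurable_funM; last exact: measurable_tnth.
  by apply: measurable_sum => i; apply: measurable_funM => //; exact: measurable_tnth.
by apply/funext => t; exact: quadE.
Qed.

Lemma measurable_gauss_kernel A : measurable_fun setT (gauss_kernel A).
Proof.
apply: measurableT_comp => //; apply: measurable_funM => //.
by apply: measurableT_comp => //; exact: measurable_quad.
Qed.

Lemma gauss_kernel_ge0 A t : 0 <= gauss_kernel A t.
Proof. exact: expR_ge0. Qed.

Lemma delta_quad j (v : 'cV[R]_n) :
  (v^T *m delta_mx j j *m v) 0 0 = v j 0 ^+ 2.
Proof.
rewrite -mulmxA -(mul_delta_mx (0 : 'I_1)) -mulmxA -rowE mulmxA.
by rewrite mxE big_ord1 -colE !mxE expr2.
Qed.

Lemma quad_tilt A j s t : quad (tilt A j s) t = quad A t + s * tnth t j ^+ 2.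
Proof.
rewrite /quad /tilt mulmxDr mulmxDl mxE -scalemxAr -scalemxAl; congr (_ + _).
by rewrite mxE delta_quad mxE.
Qed.

Lemma gauss_kernel_tilt A j s t :
  gauss_kernel (tilt A j s) t = expR (- (s * tnth t j ^+ 2 / 2)) * gauss_kernel A t.
Proof.
by rewrite /gauss_kernel quad_tilt -expRD; congr expR; ring.
Qed.

Lemma posdefmx_unit A : posdefmx A -> A \in unitmx.
Proof.
move=> [symA posA]; rewrite -row_free_unit -kermx_eq0; apply/negPn/negP.
move=> /rowV0Pn[v /sub_kermxP vA v0].
have vT0 : v^T != 0 by rewrite trmx_eq0.
by have := posA _ vT0; rewrite trmxK vA mul0mx mxE ltxx.
Qed.

Lemma posdefmx_tilt A j s : 0 <= s -> posdefmx A -> posdefmx (tilt A j s).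
Proof.
move=> s0 [symA posA]; split.
  by rewrite /tilt linearD/= linearZ/= symA trmx_delta.
move=> v v0; rewrite /tilt mulmxDr mulmxDl mxE -scalemxAr -scalemxAl.
by rewrite ltr_wpDr ?posA// mxE delta_quad mulr_ge0// sqr_ge0.
Qed.

Lemma posdefmx_inv A : posdefmx A -> posdefmx (invmx A).
Proof.
move=> pA; have uA := posdefmx_unit pA; case: (pA) => symA posA.
have symV : (invmx A)^T = invmx A by rewrite trmx_inv symA.
split=> // v v0; have := posA (invmx A *m v).
rewrite trmx_mul symV mulmxA mulmxKV// => -> //.
by apply: contra v0 => /eqP Av0; rewrite -(mulKVmx uA v) Av0 mulmx0.
Qed.

(* Completing the square in [z]: [exp(- quad A / 2)] is, up to a constant,
   the mixture of the translates by [z v] of [exp(- quad (tilt A j s) / 2)],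
   with centered Gaussian weight in [z]. *)
Lemma quad_tilt_square A j s : posdefmx A -> 0 < s ->
  exists2 v : n.-tuple R, tnth v j < 1 &
    forall (t t' : n.-tuple R) z, (forall i, tnth t' i = tnth t i - z * tnth v i) ->
    quad (tilt A j s) t' + s * (1 - tnth v j) * z ^+ 2 =
    quad A t + s * (z - tnth t j) ^+ 2.
Proof.
move=> pA s0; set B := tilt A j s.
have pB : posdefmx B by apply: posdefmx_tilt => //; exact: ltW.
have uB := posdefmx_unit pB; have [symB _] := pB; have [symA posA] := pA.
pose e : 'cV[R]_n := delta_mx j 0.
(* Solving [B v = s e_j] makes the cross term of [quad B (t - z v)] equal to [- 2 z s t_j], the one
   in [s (z - t_j)^2]. *)
pose vc := invmx B *m (s *: e).
have Bv : B *m vc = s *: e by rewrite mulKVmx.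
have ue (u : 'cV[R]_n) : (u^T *m e) 0 0 = u j 0 by rewrite -colE !mxE.
have uBv (u : 'cV[R]_n) : (u^T *m B *m vc) 0 0 = s * u j 0.
  by rewrite -mulmxA Bv -scalemxAr mxE ue.
have vBu (u : 'cV[R]_n) : (vc^T *m B *m u) 0 0 = s * u j 0.
  rewrite -uBv -[in LHS]symB -[in RHS]mulmxA -trmx_mul.
  by rewrite -[in LHS](trmxK u) -trmx_mul [LHS]mxE.
pose v := [tuple vc i 0 | i < n].
have vj : tnth v j = vc j 0 by rewrite tnth_mktuple.
exists v.
  have vc0 : vc != 0.
    apply/eqP => vc0; move: Bv; rewrite vc0 mulmx0 => /matrixP/(_ j 0).
    by rewrite !mxE !eqxx mulr1 => /esym/eqP; rewrite gt_eqF.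
  (* Computing [v^T B v] in two ways gives [v^T A v = s v_j (1 - v_j)]. The left side is positive,
     which excludes [v_j >= 1]. *)
  have := uBv vc; rewrite /B /tilt mulmxDr mulmxDl mxE -scalemxAr -scalemxAl.
  rewrite [X in _ + X]mxE delta_quad vj => /eqP.
  rewrite eq_sym -subr_eq => /eqP ab; have := posA _ vc0; rewrite -ab; move: (vc j 0) => b a0.
  rewrite ltNge; apply/negP => b1.
  have : 0 <= s * (b * (b - 1)) by rewrite !mulr_ge0 ?subr_ge0// ?ltW// (lt_le_trans ltr01).
  by lra.
move=> t t' z tt'.
have -> : quad B t' = quad B t - 2 * z * s * tnth t j + z ^+ 2 * (s * tnth v j).
  rewrite /quad (_ : tuple_col t' = tuple_col t - z *: vc); last first.
    by apply/colP => i; rewrite !mxE tt' /v tnth_mktuple mxE.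
  have -> : (tuple_col t - z *: vc)^T = (tuple_col t)^T - z *: vc^T.
    by apply/matrixP => k l; rewrite !mxE.
  rewrite !(mulmxBl, mulmxBr) -!scalemxAr -!scalemxAl.
  have DE (M N : 'M[R]_1) : (M + N) 0 0 = M 0 0 + N 0 0 by rewrite mxE.
  have NE (M : 'M[R]_1) : (- M) 0 0 = - M 0 0 by rewrite mxE.
  have ZE c (M : 'M[R]_1) : (c *: M) 0 0 = c * M 0 0 by rewrite mxE.
  rewrite !(DE, NE, ZE). rewrite (uBv (tuple_col t)) (vBu (tuple_col t)) (uBv vc) vj [tuple_col t j 0]mxE.
  by ring.
by rewrite quad_tilt; ring.
Qed.

End quadratic_form.

(** * Tilting the kernel lowers the mean of a symmetric midpoint-convex function *)

Section tilting.
Local Open Scope ereal_scope.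
Context {R : realType}.
Local Notation mu := (@lebesgue_measure R).

Lemma integral_expR_square (s m : R) : (0 < s)%R ->
  \int[mu]_z (expR (- (s * (z - m) ^+ 2 / 2)))%:E =
  (Num.sqrt (2 / s) * Num.sqrt pi)%:E.
Proof.
move=> s0; have s2 : (0 < 2 / s)%R by rewrite divr_gt0.
rewrite (@ge0_integral_affine _ (Num.sqrt (2 / s)) m); last 3 first.
- by rewrite sqrtr_gt0.
- apply/measurable_EFinP; apply: measurableT_comp => //.
  apply: measurableT_comp => //; apply: measurable_funM => //.
  apply: measurable_funM => //; apply: measurable_funX.
  exact: measurable_funB.
- by move=> z; rewrite lee_fin expR_ge0.
rewrite EFinM -integralT_gauss; congr (_ * _); apply: eq_integral => z _.
rewrite /gauss_fun addrK exprMn sqr_sqrtr ?ltW//; congr (expR _)%:E.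
by field; rewrite gt_eqF.
Qed.

Lemma integral_expR_square0 (s : R) : (0 < s)%R ->
  \int[mu]_z (expR (- (s * z ^+ 2 / 2)))%:E =
  (Num.sqrt (2 / s) * Num.sqrt pi)%:E.
Proof.
move=> s0; rewrite -(integral_expR_square 0 s0).
by apply: eq_integral => z _; rewrite subr0.
Qed.

Context {n : nat}.
Local Notation leb := (lebesgue_tuple R n).

Definition tuple_scale (z : R) (v : n.-tuple R) : n.-tuple R :=
  [tuple (z * tnth v i)%R | i < n].

Lemma tnth_tuple_scale z v i : tnth (tuple_scale z v) i = (z * tnth v i)%R.
Proof. by rewrite tnth_mktuple. Qed.

Lemma measurable_tuple_add_scale (v : n.-tuple R) :
  measurable_fun setT
    (fun p : measurableTypeR R * n.-tuple R => tuple_add p.2 (tuple_scale p.1 v)).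
Proof.
apply/measurable_fun_tnthP => i /=.
rewrite (_ : _ \o _ = fun p => (tnth p.2 i + p.1 * tnth v i)%R).
  apply: measurable_funD; last exact: measurable_funM.
  by apply: (measurableT_comp (measurable_tnth i)).
by apply/funext => x /=; rewrite tnth_tuple_add tnth_tuple_scale.
Qed.

(** Integrated form of [quad_tilt_square]. Here [k] is the integral over [z] of
    [exp(- s (z - t_j)^2 / 2)], which does not depend on [t], and [w z] is [exp(- r z^2 / 2)] with
    [r = s (1 - v_j)], positive because [v_j < 1]. *)
Lemma gauss_kernel_mixture (A : 'M[R]_n) j (s : R) : posdefmx A -> (0 < s)%R ->
  exists v (k K : R), [/\ (0 < k)%R, (0 < K)%R &
    exists w : R -> R, [/\ measurable_fun setT w, (forall z, 0 <= w z)%R,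
      (forall z, w (- z) = w z)%R, \int[mu]_z (w z)%:E = K%:E &
      forall G : n.-tuple R -> R, measurable_fun setT G -> (forall t, 0 <= G t)%R ->
      k%:E * \int[leb]_t (G t * gauss_kernel A t)%:E =
      \int[mu]_z ((w z)%:E * \int[leb]_t
        (G (tuple_add t (tuple_scale z v)) * gauss_kernel (tilt A j s) t)%:E)]].
Proof.
move=> pA s0; have [v vj1 vE] := quad_tilt_square j pA s0.
pose r := (s * (1 - tnth v j))%R.
have r0 : (0 < r)%R by rewrite mulr_gt0// subr_gt0.
exists v, (Num.sqrt (2 / s) * Num.sqrt pi)%R, (Num.sqrt (2 / r) * Num.sqrt pi)%R.
have pos x : (0 < x -> 0 < Num.sqrt (2 / x) * Num.sqrt pi :> R)%R.
  by move=> x0; rewrite mulr_gt0// sqrtr_gt0 ?pi_gt0// divr_gt0.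
split; [exact: pos|exact: pos|].
pose w z := expR (- (r * z ^+ 2 / 2)).
have mw : measurable_fun setT w.
  apply: measurableT_comp => //; apply: measurableT_comp => //.
  apply: measurable_funM => //; apply: measurable_funM => //.
exists w; split => //.
- by move=> z; exact: expR_ge0.
- by move=> z; rewrite /w sqrrN.
- exact: integral_expR_square0.
move=> G mG G0.
(* Joint integrand on the product space: integrating [z] out first gives the left-hand side,
   integrating [t] out first gives the right-hand side. *)
pose H z t := (G t * gauss_kernel A t * expR (- (s * (z - tnth t j) ^+ 2 / 2)))%R.
have H0 z t : (0 <= (H z t)%:E) by rewrite lee_fin !mulr_ge0// expR_ge0.
have mG' : measurable_fun setT (fun p : measurableTypeR R * n.-tuple R => G p.2).
  exact: (measurableT_comp mG).
have mK B : measurable_fun setT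
    (fun p : measurableTypeR R * n.-tuple R => @gauss_kernel R n B p.2).
  exact: (measurableT_comp (measurable_gauss_kernel B)).
have mH : measurable_fun setT
    (fun p : measurableTypeR R * n.-tuple R => (H p.1 p.2)%:E).
  apply/measurable_EFinP; apply: measurable_funM; first exact: measurable_funM.
  apply: measurableT_comp => //; apply: measurableT_comp => //.
  apply: measurable_funM => //; apply: measurable_funM => //.
  apply: measurable_funX; apply: measurable_funB => //.
  exact: (measurableT_comp (measurable_tnth j)).
transitivity (\int[mu]_z \int[leb]_t (H z t)%:E).
  rewrite (@fubini_tonelli _ _ _ _ _ mu leb (fun p => (H p.1 p.2)%:E))//=.
  rewrite -ge0_integralZl//; last 2 first.
  - apply/measurable_EFinP; apply: measurable_funM => //.
    exact: measurable_gauss_kernel.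
  - by move=> t _; rewrite lee_fin mulr_ge0// expR_ge0.
  apply: eq_integral => t _; rewrite -(integral_expR_square (tnth t j) s0).
  rewrite muleC -ge0_integralZl//.
  - apply/measurable_EFinP; apply: measurableT_comp => //; apply: measurableT_comp => //.
    apply: measurable_funM => //; apply: measurable_funM => //.
    by apply: measurable_funX; exact: measurable_funB.
  - by rewrite lee_fin mulr_ge0// expR_ge0.
apply: eq_integral => z _.
have mGK : measurable_fun setT (fun t =>
    (G (tuple_add t (tuple_scale z v)) * gauss_kernel (tilt A j s) t)%:E).
  apply/measurable_EFinP; apply: measurable_funM.
    by apply: (measurableT_comp mG); exact: measurable_tuple_addr.
  exact: measurable_gauss_kernel.
have GK0 t : 0 <= (G (tuple_add t (tuple_scale z v)) * gauss_kernel (tilt A j s) t)%:E.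
  by rewrite lee_fin mulr_ge0// expR_ge0.
(* Translating by [- z v] moves the shift from [G] to the kernel, where the completed square
   applies. *)
rewrite -[X in _ = _ * X](ge0_integral_tuple_add (tuple_scale (- z) v))//.
rewrite -ge0_integralZl//; last 2 first.
- by apply: (measurableT_comp mGK); exact: measurable_tuple_addr.
- by rewrite lee_fin expR_ge0.
apply: eq_integral => t _; rewrite -EFinM; congr (_%:E).
rewrite (_ : tuple_add (tuple_add _ _) _ = t); last first.
  apply: eq_from_tnth => i.
  by rewrite !tnth_tuple_add !tnth_tuple_scale mulNr subrK.
rewrite /H -mulrA [RHS]mulrCA; congr (_ * _)%R; rewrite /gauss_kernel /w -!expRD.
have h : forall i, (tnth (tuple_add t (tuple_scale (- z) v)) i =
    tnth t i - z * tnth v i)%R.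
  by move=> i; rewrite tnth_tuple_add tnth_tuple_scale mulNr.
by have := vE _ _ _ h; rewrite -/r => {}h; congr expR; lra.
Qed.

(** The constant [c] bounds the mean of [g] under the kernel of [A]. That kernel is an even mixture
    of translates of the tilted one, and averaging a midpoint-convex [g] over the shifts [z v] and
    [- z v] can only increase its mean. So the tilted mean is bounded by [c] as well. *)
Lemma tilt_le (A : 'M[R]_n) j (s : R) (g : n.-tuple R -> R) (c : R) :
  posdefmx A -> (0 <= s)%R -> measurable_fun setT g -> (forall t, 0 <= g t)%R ->
  (forall x y z, (forall i, 2 * tnth x i = tnth y i + tnth z i) ->
     2 * g x <= g y + g z)%R ->
  (0 <= c)%R ->
  \int[leb]_t (g t * gauss_kernel A t)%:E <= c%:E * \int[leb]_t (gauss_kernel A t)%:E ->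
  \int[leb]_t (g t * gauss_kernel (tilt A j s) t)%:E <=
  c%:E * \int[leb]_t (gauss_kernel (tilt A j s) t)%:E.
Proof.
move=> pA; rewrite le_eqVlt => /predU1P[<-|s0] mg g0 gc c0 gA.
  by rewrite /tilt scale0r addr0.
have [v [k [K [k0 K0 [w [mw w0 wN wK kK]]]]]] := gauss_kernel_mixture j pA s0.
set B := tilt A j s.
(* The mixture identity at [G = 1] compares the total masses of the two kernels. *)
have one : k%:E * \int[leb]_t (gauss_kernel A t)%:E =
    K%:E * \int[leb]_t (gauss_kernel B t)%:E.
  transitivity (k%:E * \int[leb]_t ((fun=> 1%R) t * gauss_kernel A t)%:E).
    by congr (_ * _); apply: eq_integral => t _; rewrite mul1r.
  rewrite kK//; transitivity (\int[mu]_z ((w z)%:E * \int[leb]_t (gauss_kernel B t)%:E)).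
    apply: eq_integral => z _; congr (_ * _).
    by apply: eq_integral => t _; rewrite mul1r.
  rewrite -wK ge0_integralZr//.
  - exact/measurable_EFinP.
  - by move=> z _; rewrite lee_fin.
  - by apply: integral_ge0 => t _; rewrite lee_fin expR_ge0.
pose F z := \int[leb]_t (g (tuple_add t (tuple_scale z v)) * gauss_kernel B t)%:E.
have F0 z : 0 <= F z by apply: integral_ge0 => t _; rewrite lee_fin mulr_ge0// expR_ge0.
have mF : measurable_fun setT F.
  apply: (@measurable_fun_fubini_tonelli_F _ _ _ _ _ leb
    (fun p => (g (tuple_add p.2 (tuple_scale p.1 v)) * gauss_kernel B p.2)%:E)).
    apply/measurable_EFinP; apply: measurable_funM.
      by apply: (measurableT_comp mg); exact: measurable_tuple_add_scale.
    exact: (measurableT_comp (measurable_gauss_kernel B)).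
  by move=> p; rewrite lee_fin mulr_ge0// expR_ge0.
have mwF : measurable_fun setT (fun z => (w z)%:E * F z).
  by apply: emeasurable_funM => //; exact/measurable_EFinP.
have wF0 z : 0 <= (w z)%:E * F z by rewrite mule_ge0// lee_fin.
(* Midpoint convexity at [t], the midpoint of [t + z v] and [t - z v], integrated against the tilted
   kernel. *)
have conv z : 2%:E * \int[leb]_t (g t * gauss_kernel B t)%:E <= F z + F (- z)%R.
  have mK : measurable_fun setT (gauss_kernel B) := measurable_gauss_kernel B.
  have mgz y : measurable_fun setT
      (fun t => (g (tuple_add t (tuple_scale y v)) * gauss_kernel B t)%:E).
    apply/measurable_EFinP; apply: measurable_funM => //.
    by apply: (measurableT_comp mg); exact: measurable_tuple_addr.
  rewrite -ge0_integralZl//; last 2 first.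
  - by apply/measurable_EFinP; exact: measurable_funM.
  - by move=> t _; rewrite lee_fin mulr_ge0// expR_ge0.
  rewrite -ge0_integralD//; last 2 first.
  - by move=> t _; rewrite lee_fin mulr_ge0// expR_ge0.
  - by move=> t _; rewrite lee_fin mulr_ge0// expR_ge0.
  apply: ge0_le_integral => //.
  - by move=> t _; rewrite mule_ge0// lee_fin mulr_ge0// expR_ge0.
  - by apply: emeasurable_funM => //; apply/measurable_EFinP; exact: measurable_funM.
  - exact: emeasurable_funD.
  move=> t _; rewrite -EFinM -EFinD lee_fin mulrA -mulrDl ler_wpM2r ?expR_ge0//.
  apply: gc => i; rewrite !tnth_tuple_add !tnth_tuple_scale; ring.
have main : K%:E * \int[leb]_t (g t * gauss_kernel B t)%:E <=
    k%:E * \int[leb]_t (g t * gauss_kernel A t)%:E.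
  rewrite kK//.
  rewrite -(@lee_pmul2l _ 2%:E)//.
  (* Since [w] is even, reflecting [z] in one of two copies of the integral pairs [F z] with
     [F (- z)]. *)
  rewrite [leRHS](_ : _ = \int[mu]_z ((w z)%:E * (F z + F (- z)%R))); last first.
    rewrite mule_natl mule2n -/(F _).
    rewrite -[X in _ + X](ge0_integral_opp mwF)// -ge0_integralD//.
      by apply: eq_integral => z _; rewrite wN [RHS](ge0_muleDr _ (F0 z) (F0 (- z)%R)).
    have mN : measurable_fun setT (-%R : R -> R) by [].
    exact: (measurableT_comp mwF mN).
  rewrite muleCA -wK.
  rewrite -ge0_integralZr//; last 3 first.
  - exact/measurable_EFinP.
  - by move=> z _; rewrite lee_fin.
  - by rewrite mule_ge0// integral_ge0// => t _; rewrite lee_fin mulr_ge0// expR_ge0.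
  apply: ge0_le_integral => //.
  - move=> z _; rewrite mule_ge0// ?lee_fin// mule_ge0// integral_ge0// => t _.
    by rewrite lee_fin mulr_ge0// expR_ge0.
  - by apply: emeasurable_funM => //; exact/measurable_EFinP.
  - apply: emeasurable_funM; first exact/measurable_EFinP.
    by apply: emeasurable_funD => //; exact: (measurableT_comp mF).
  - by move=> z _; rewrite lee_wpmul2l// lee_fin.
rewrite -(@lee_pmul2l _ K%:E)//.
rewrite (le_trans main)// muleCA -one muleCA lee_wpmul2l// lee_fin.
exact: ltW.
Qed.

End tilting.

(** * Negative powers as mixtures of Gaussian kernels *)

Section power_mixture.
Local Open Scope classical_set_scope.
Local Open Scope ereal_scope.
Context {R : realType}.
Local Notation mu := (@lebesgue_measure R).

Lemma measurable_expR_powR (p x : R) :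
  measurable_fun setT (fun u : R => expR (- (`|u| `^ p * x))).
Proof.
apply: measurableT_comp => //; apply: measurableT_comp => //.
apply: measurable_funM => //.
apply: (measurableT_comp (measurable_powR p)).
exact: normr_measurable.
Qed.

(** Used with [p = 1 / nu], which exceeds 2 for [nu < 1/2]. Then [u^2 <= 1 + |u|^p] bounds the
    integrand by [e exp(- u^2)], so the integral is finite; it is positive because the integrand is
    at least [exp(- 1)] on [0, 1]. *)
Lemma integral_expR_powR1 (p : R) : (2 <= p)%R ->
  exists2 C : R, (0 < C)%R &
    \int[mu]_u (expR (- (`|u| `^ p * 1)))%:E = C%:E.
Proof.
move=> p2; set I := \int[mu]_u _.
have mf := measurable_expR_powR p 1.
have Ifin : I < +oo.
  apply: (@le_lt_trans _ _ ((expR 1)%:E * (Num.sqrt pi)%:E)); last first.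
    by rewrite -EFinM ltry.
  rewrite -integralT_gauss -ge0_integralZl//; last 2 first.
  - apply/measurable_EFinP; exact: measurable_gauss_fun.
  - by move=> u _; rewrite lee_fin gauss_fun_ge0.
  apply: ge0_le_integral => //.
  - exact/measurable_EFinP.
  - apply/measurable_EFinP; apply: measurable_funM => //.
    exact: measurable_gauss_fun.
  move=> u _; rewrite -EFinM lee_fin /gauss_fun -expRD ler_expR mulr1.
  have : (`|u| ^+ 2 <= 1 + `|u| `^ p)%R.
    have [u1|u1] := leP 1%R `|u|%R.
      rewrite -powR_mulrn// ler_wpDl// ler_powR//.
    rewrite ler_wpDr ?powR_ge0// expr_le1// ltW//.
  by rewrite real_normK ?num_real//; lra.
have Ipos : 0 < I.
  apply: (@lt_le_trans _ _ (expR (- 1))%:E); first by rewrite lte_fin expR_gt0.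
  apply: (@le_trans _ _ (\int[mu]_(u in `[0%R, 1%R]) (expR (- (`|u| `^ p * 1)))%:E)).
    rewrite [leLHS](_ : _ = \int[mu]_(u in `[0%R, 1%R]) (expR (- 1))%:E).
      apply: ge0_le_integral => //.
      - by apply/measurable_EFinP; exact: measurable_funTS.
      move=> u /=; rewrite in_itv/= => /andP[u0 u1].
      rewrite lee_fin ler_expR lerN2 mulr1 ger0_norm//.
      rewrite [leRHS](_ : _ = (1 `^ p)%R); last by rewrite powR1.
        rewrite ge0_ler_powR ?nnegrE//.
      exact: le_trans p2.
    by rewrite integral_cst//= lebesgue_measure_itv/= lte01 oppr0 adde0 mule1.
  apply: ge0_subset_integral => //.
  exact/measurable_EFinP.
exists (fine I); first by rewrite fine_gt0// Ipos.
by rewrite fineK// ge0_fin_numE// ltW.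
Qed.

Lemma powR_mixture (nu : R) : (0 < nu)%R -> (nu < 1 / 2)%R ->
  exists2 C : R, (0 < C)%R & forall x : R, x != 0%R ->
    \int[mu]_u (expR (- (`|u| `^ nu^-1 * x ^+ 2)))%:E =
    (C * `|x| `^ (- 2 * nu))%:E.
Proof.
move=> nu0 nu2; have [|C C0 CE] := @integral_expR_powR1 nu^-1.
  by rewrite -[leLHS]invrK lef_pV2 ?posrE ?invr_gt0// -div1r ltW.
exists C => // x x0.
have x1 : (0 < `|x|)%R by rewrite normr_gt0.
(* Scaling [u] by [|x|^(- 2 nu)] multiplies [|u|^(1 / nu)] by [|x|^(- 2)], which cancels [x^2] in
   the exponent. *)
rewrite (@ge0_integral_affine _ (`|x| `^ (- 2 * nu)) 0)//.
- rewrite [in RHS]mulrC [RHS]EFinM -CE; congr (_ * _); apply: eq_integral => u _.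
  rewrite addr0 normrM powRM// ger0_norm ?powR_ge0// -powRrM.
  rewrite mulfK ?gt_eqF// powRN powR_mulrn// real_normK ?num_real//.
  by congr (expR (- _))%:E; field.
- by rewrite powR_gt0.
- by apply/measurable_EFinP; exact: measurable_expR_powR.
Qed.

Context {n : nat}.
Local Notation leb := (lebesgue_tuple R n).

Lemma measurable_tnth_powR (j : 'I_n) (a : R) :
  measurable_fun setT (fun t : n.-tuple R => `|tnth t j| `^ a)%R.
Proof.
apply: (measurableT_comp (measurable_powR a)).
apply: measurableT_comp => //; exact: measurable_tnth.
Qed.

(** Tonelli applied to [powR_mixture]; the factor 2 in the tilt cancels the 1/2 in [gauss_kernel].
    The constant [C] is chosen before [A] and [G], so that one [C] serves both sides of a
    comparison. *)
Lemma tilt_mixture (j : 'I_n) (nu : R) : (0 < nu)%R -> (nu < 1 / 2)%R ->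
  exists2 C : R, (0 < C)%R & forall (A : 'M[R]_n) (G : n.-tuple R -> R),
    measurable_fun setT G -> (forall t, 0 <= G t)%R ->
    measurable_fun setT (fun u : measurableTypeR R =>
      \int[leb]_t (G t * gauss_kernel (tilt A j (2 * `|u| `^ nu^-1)) t)%:E) /\
    C%:E * \int[leb]_t (`|tnth t j| `^ (- 2 * nu) * G t * gauss_kernel A t)%:E =
    \int[mu]_u \int[leb]_t
      (G t * gauss_kernel (tilt A j (2 * `|u| `^ nu^-1)) t)%:E.
Proof.
move=> nu0 nu2; have [C C0 CE] := powR_mixture nu0 nu2.
exists C => // A G mG G0.
pose H (p : measurableTypeR R * n.-tuple R) : \bar R :=
  (G p.2 * gauss_kernel (tilt A j (2 * `|p.1| `^ nu^-1)) p.2)%:E.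
have HE u t : H (u, t) =
    (G t * gauss_kernel A t)%:E * (expR (- (`|u| `^ nu^-1 * tnth t j ^+ 2)))%:E.
  rewrite /H/= gauss_kernel_tilt -EFinM; congr (_%:E).
  rewrite mulrCA [RHS]mulrC; congr (expR _ * _)%R; by field.
have mH : measurable_fun setT H.
  rewrite (_ : H = fun p => (G p.2 * gauss_kernel A p.2 *
      expR (- (`|p.1| `^ nu^-1 * tnth p.2 j ^+ 2)))%:E); last first.
    by apply/funext => -[u t]; rewrite HE.
  apply/measurable_EFinP; apply: measurable_funM.
    apply: measurable_funM; first exact: (measurableT_comp mG).
    exact: (measurableT_comp (measurable_gauss_kernel A)).
  apply: measurableT_comp => //; apply: measurableT_comp => //.
  apply: measurable_funM.
    apply: (measurableT_comp (measurable_powR _)).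
    by apply: measurableT_comp; [exact: normr_measurable|exact: measurable_fst].
  by apply: measurable_funX; exact: (measurableT_comp (measurable_tnth j)).
have H0 p : 0 <= H p by rewrite lee_fin mulr_ge0// expR_ge0.
split; first exact: (@measurable_fun_fubini_tonelli_F _ _ _ _ _ leb H).
rewrite (@fubini_tonelli _ _ _ _ _ mu leb H)//.
have mPG : measurable_fun setT
    (fun t : n.-tuple R => `|tnth t j| `^ (- 2 * nu) * G t * gauss_kernel A t)%R.
  apply: measurable_funM; last exact: measurable_gauss_kernel.
  by apply: measurable_funM => //; exact: measurable_tnth_powR.
rewrite -ge0_integralZl//; last 3 first.
- exact/measurable_EFinP.
- by move=> t _; rewrite lee_fin !mulr_ge0// ?powR_ge0 ?expR_ge0.
- by rewrite lee_fin ltW.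
(* Equality of the integrands is claimed only off [t_j = 0]: there [powR] takes the value 0 at a
   negative exponent, whereas the integral over [u] of the constant 1 diverges. *)
apply: ge0_ae_eq_integral => //.
- by apply: emeasurable_funM => //; exact/measurable_EFinP.
- exact: (@measurable_fun_fubini_tonelli_G _ _ _ _ _ mu H).
- move=> t _; apply: mule_ge0; rewrite lee_fin; first exact: ltW.
  by rewrite !mulr_ge0// ?powR_ge0 ?expR_ge0.
- by move=> t _; exact: integral_ge0.
exists [set t | tnth t j = 0%R]; split.
- rewrite (_ : [set t | _] = (@tnth n R ^~ j) @^-1` [set 0%R])//.
  by rewrite -[X in measurable X]setTI; exact: measurable_tnth.
- exact: lebesgue_tuple_hyperplane.
move=> t; apply: contra_notP => /eqP tj0 _.
under [RHS]eq_integral do rewrite HE.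
rewrite ge0_integralZl//; last 2 first.
- by apply/measurable_EFinP; exact: measurable_expR_powR.
- by rewrite lee_fin mulr_ge0// expR_ge0.
by rewrite CE// -!EFinM; congr (_%:E); ring.
Qed.

Variables (g : n.-tuple R -> R) (c : R).
Hypotheses (mg : measurable_fun setT g) (g0 : forall t, (0 <= g t)%R).
Hypothesis gc : forall x y z, (forall i, 2 * tnth x i = tnth y i + tnth z i)%R ->
  (2 * g x <= g y + g z)%R.
Hypothesis c0 : (0 <= c)%R.

(** Induction on [s] with [A] general: writing one factor as a mixture over [u] leaves, for each
    [u], the inequality for the shorter product and a tilted matrix. [tilt_le] carries the bound on
    the mean of [g] over to that matrix. *)
Lemma prod_powR_le (s : seq 'I_n) (nu : 'I_n -> R) (A : 'M[R]_n) :
  (forall j, j \in s -> 0 <= nu j < 1 / 2)%R -> posdefmx A ->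
  \int[leb]_t (g t * gauss_kernel A t)%:E <= c%:E * \int[leb]_t (gauss_kernel A t)%:E ->
  \int[leb]_t ((\prod_(j <- s) `|tnth t j| `^ (- 2 * nu j)) * g t * gauss_kernel A t)%:E
  <= c%:E * \int[leb]_t
     ((\prod_(j <- s) `|tnth t j| `^ (- 2 * nu j)) * gauss_kernel A t)%:E.
Proof.
elim: s A => [|j s IHs] A nus pA gA.
  under eq_integral do rewrite big_nil mul1r.
  by under [in leRHS]eq_integral do rewrite big_nil mul1r.
have /andP[nu0 nu2] := nus j (mem_head _ _).
have nus' k : k \in s -> (0 <= nu k < 1 / 2)%R.
  by move=> ks; apply: nus; rewrite inE ks orbT.
pose psi (t : n.-tuple R) := (\prod_(k <- s) `|tnth t k| `^ (- 2 * nu k))%R.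
have psi0 t : (0 <= psi t)%R by apply: prodr_ge0 => k _; exact: powR_ge0.
have mpsi : measurable_fun setT psi.
  by apply: measurable_prod => k _; exact: measurable_tnth_powR.
(* A zero exponent has no mixture representation, but its factor is identically 1, even at 0. *)
move: nu0; rewrite le_eqVlt => /predU1P[nu0|nu0].
  under eq_integral do rewrite big_cons -nu0 mulr0 powRr0 mul1r.
  under [in leRHS]eq_integral do rewrite big_cons -nu0 mulr0 powRr0 mul1r.
  exact: IHs.
under eq_integral do rewrite big_cons -[X in (X * _)%R]mulrA -/(psi _).
under [in leRHS]eq_integral do rewrite big_cons -/(psi _).
have [C C0 CE] := tilt_mixture j nu0 nu2.
have [m1 e1] := CE A (fun t => psi t * g t)%R (measurable_funM mpsi mg)
  (fun t => mulr_ge0 (psi0 t) (g0 t)).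
have [m2 e2] := CE A psi mpsi psi0.
rewrite -(@lee_pmul2l _ C%:E)// muleCA e1 e2 -ge0_integralZl//; last first.
  by move=> u _; apply: integral_ge0 => t _; rewrite lee_fin mulr_ge0// expR_ge0.
have s0 (u : R) : (0 <= 2 * `|u| `^ (nu j)^-1)%R by rewrite mulr_ge0// powR_ge0.
apply: ge0_le_integral => //.
- by move=> u _; apply: integral_ge0 => t _; rewrite lee_fin !mulr_ge0// expR_ge0.
- by apply: emeasurable_funM.
move=> u _; apply: IHs => //; first exact: posdefmx_tilt.
exact: tilt_le.
Qed.

End power_mixture.

(** * Densities, weighted means and convexity *)

Lemma ge0_integral_density d (T : measurableType d) (R : realType)
    (nu : {finite_measure set T -> \bar R})
    (mu : {sigma_finite_measure set T -> \bar R}) (p : T -> R) (f : T -> \bar R) :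
  measurable_fun setT p -> (forall x, 0 <= p x) ->
  (forall A, measurable A -> nu A = (\int[mu]_(x in A) (p x)%:E)%E) ->
  measurable_fun setT f -> (forall x, 0 <= f x)%E ->
  (\int[nu]_x f x = \int[mu]_x (f x * (p x)%:E))%E.
Proof.
move=> mp p0 nuE mf f0.
have mpE : measurable_fun setT (fun x => (p x)%:E) by apply/measurable_EFinP.
have numu : nu `<< mu.
  apply/null_content_dominatesP => A mA muA0; rewrite nuE//.
  rewrite (eq_integral (fun x => `|(p x)%:E|%E)).
    by apply: integral_abs_eq0 => //; exact: measurable_funTS.
  by move=> x _; rewrite gee0_abs// lee_fin.
(* The change of variables holds for the Radon-Nikodym derivative, which agrees with [p] almost
   everywhere since both have the same integral over every measurable set. *)
rewrite -(Radon_Nikodym_SigmaFinite.change_of_variables numu f0)//.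
have fi := Radon_Nikodym_SigmaFinite.f_integrable numu.
apply: ae_eq_integral => //.
- by apply: emeasurable_funM => //; exact: measurable_int fi.
- exact: emeasurable_funM.
apply: ae_eqe_mul2l; apply: integral_ae_eq => // A _ mA.
by rewrite -Radon_Nikodym_SigmaFinite.f_integral// nuE.
Qed.

(** With [S] the weighted mean, [1 + x <= exp x] gives [a_i <= S exp(a_i / S - 1)]. In the product
    of the powers [2 nu_i] the exponentials cancel, because the sum of [nu_i a_i] is [nubar S]. *)
Lemma weighted_amgm (R : realType) (I : finType) (A : {set I}) (nu a : I -> R) (nubar : R) :
  (forall i, i \in A -> 0 <= nu i) -> (forall i, 0 <= a i) ->
  nubar = \sum_(i in A) nu i -> 0 < nubar ->
  \prod_(i in A) a i `^ (2 * nu i) <=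
  (\sum_(i in A) nu i / nubar * a i) `^ (2 * nubar).
Proof.
move=> nu0 a0 nuE nub0; set S := \sum_(i in A) _.
have term0 i : i \in A -> 0 <= nu i / nubar * a i.
  by move=> iA; rewrite !mulr_ge0// ?invr_ge0 ?nu0// ltW.
have S0 : 0 <= S by apply: sumr_ge0.
(* If [S = 0], some [nu_i] is positive, so [a_i = 0] and the product on the left vanishes. *)
move: S0; rewrite le_eqVlt => /predU1P[S0|S0].
  have [i iA nui] : exists2 i, i \in A & 0 < nu i.
    apply: contrapT => h; move: nub0; rewrite nuE big1 ?ltxx// => i iA.
    apply/eqP; rewrite eq_le nu0// andbT leNgt; apply/negP => nui.
    by apply: h; exists i.
  rewrite (bigD1 i)//= (_ : a i = 0) ?powR0 ?mul0r ?powR_ge0//.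
    by rewrite mulf_neq0// gt_eqF.
  have /eqP := esym S0; rewrite psumr_eq0// => /allP/(_ i (mem_index_enum _)).
  by rewrite iA/= !mulf_eq0 invr_eq0 (gt_eqF nui) (gt_eqF nub0) => /eqP.
have aS i : a i <= S * expR (a i / S - 1).
  rewrite mulrC -ler_pdivrMr//.
  by apply: le_trans (expR_ge1Dx _); rewrite addrC subrK.
apply: (@le_trans _ _ (\prod_(i in A)
    (S `^ (2 * nu i) * expR (2 * nu i * (a i / S - 1))))).
  apply: ler_prod => i iA; rewrite powR_ge0/=.
  have nui : 0 <= 2 * nu i by rewrite mulr_ge0// nu0.
  apply: le_trans (ge0_ler_powR nui _ _ (aS i)) _.
  - by rewrite nnegrE.
  - by rewrite nnegrE mulr_ge0// ?expR_ge0// ltW.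
  rewrite powRM ?expR_ge0 ?(ltW S0)// [X in _ * X]/powR gt_eqF ?expR_gt0//.
  by rewrite expRK.
rewrite big_split/= -expR_sum.
have -> : \sum_(i in A) 2 * nu i * (a i / S - 1) = 0.
  transitivity (2 * nubar / S * S - 2 * \sum_(i in A) nu i).
    have SE : S = \sum_(i in A) nu i / nubar * a i by [].
    rewrite [X in _ = _ * X - _]SE !mulr_sumr -sumrB; apply: eq_bigr => i _.
    by field; rewrite !gt_eqF.
  by rewrite -nuE mulfVK ?gt_eqF// subrr.
rewrite expR0 mulr1 /powR gt_eqF// -expR_sum nuE.
by rewrite ler_expR -mulr_suml -mulr_sumr.
Qed.

(** The weighted l1 norm satisfies the triangle inequality, and [r |-> r^p] is nondecreasing and
    convex on the half-line for [p >= 1]. *)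
Lemma convex_norm_powR (R : realType) n (A : {set 'I_n}) (w : 'I_n -> R) (p : R)
    (x y z : n.-tuple R) :
  (forall i, i \in A -> 0 <= w i) -> 1 <= p ->
  (forall i, 2 * tnth x i = tnth y i + tnth z i) ->
  2 * (\sum_(i in A) w i * `|tnth x i|) `^ p <=
  (\sum_(i in A) w i * `|tnth y i|) `^ p + (\sum_(i in A) w i * `|tnth z i|) `^ p.
Proof.
move=> w0 p1 xyz.
pose N (t : n.-tuple R) := \sum_(i in A) w i * `|tnth t i|.
have N0 t : 0 <= N t by apply: sumr_ge0 => i iA; rewrite mulr_ge0// w0.
have Nx : N x <= 2^-1 * N y + 2^-1 * N z.
  rewrite -mulrDr -big_split/= mulr_sumr; apply: ler_sum => i iA.
  rewrite -mulrDr mulrCA ler_wpM2l ?w0//.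
  rewrite -(ler_pM2l (ltr0Sn R 1)) mulrA divff// mul1r.
  by rewrite -[2 in leLHS]ger0_norm// -normrM xyz ler_normD.
have h01 : 0 <= 2^-1 :> R by rewrite invr_ge0.
have h02 : 2^-1 <= 1 :> R by rewrite invf_le1 ?ltr0n ?ler1n.
have := @convex_powR R p p1 (Itv01 h01 h02) (N y) (N z).
have inI r : 0 <= r -> r \in (`[0, +oo[%classic : set R).
  by move=> r0; rewrite inE/= in_itv/= r0.
move=> /(_ (inI _ (N0 y)) (inI _ (N0 z))).
rewrite convRE [X in X `^ _ <= _]convRE/=.
rewrite (_ : unstable.onem 2^-1 = 2^-1); last by rewrite /unstable.onem; field.
move=> cvx.
have h : N x `^ p <= 2^-1 * N y `^ p + 2^-1 * N z `^ p.
  apply: le_trans cvx; apply: ge0_ler_powR (N0 x) _ Nx.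
    exact: le_trans p1.
  by rewrite nnegrE addr_ge0// mulr_ge0.
rewrite -/(N x) -/(N y) -/(N z). lra.
Qed.

(** Turns expectations into integrals against the unnormalised kernel with precision [invmx Sigma],
    isolating a constant that does not depend on [F]. *)
Lemma gaussian_expectation (R : realType) (disp : measure_display)
    (T : measurableType disp) (P : probability T R) (d : nat) (Sigma : 'M[R]_d)
    (X : {RV P >-> d.-tuple R}) (F : d.-tuple R -> R) :
  gaussian_vector P Sigma X -> measurable_fun setT F -> (forall t, 0 <= F t) ->
  (\int[P]_w (F (X w))%:E =
   ((Num.sqrt ((2 * pi) ^+ d * \det Sigma))^-1)%:E *
   \int[lebesgue_tuple R d]_t (F t * gauss_kernel (invmx Sigma) t)%:E)%E.
Proof.
move=> XG mF F0; set k := (Num.sqrt _)^-1.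
have k0 : 0 <= k by rewrite invr_ge0 sqrtr_ge0.
have mFE : measurable_fun setT (fun t => (F t)%:E) by apply/measurable_EFinP.
have mK := measurable_gauss_kernel (invmx Sigma).
rewrite -(@ge0_integral_distribution _ _ _ _ _ P X (fun t => (F t)%:E))//.
rewrite (@ge0_integral_density _ _ _ (distribution P X) (lebesgue_tuple R d)
  (gaussian_pdf Sigma))//; last 2 first.
- exact: measurable_funM.
- by move=> t; rewrite mulr_ge0// expR_ge0.
rewrite -ge0_integralZl//; last 2 first.
- by apply/measurable_EFinP; exact: measurable_funM.
- by move=> t _; rewrite lee_fin mulr_ge0// expR_ge0.
by apply: eq_integral => t _; rewrite -!EFinM mulrCA.
Qed.

(** * The inequality for Gaussian vectors *)

Theorem corollary2 (R : realType) (disp : measure_display)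
    (T : measurableType disp) (P : probability T R)
    (d : nat) (Sigma : 'M[R]_d) (X : {RV P >-> d.-tuple R})
    (J : {set 'I_d}) (nu : 'I_d -> R) (nubar : R) :
  posdefmx Sigma ->
  gaussian_vector P Sigma X ->
  J != finset.set0 -> J \proper [set: 'I_d]%SET ->
  (forall j, j \in J -> 0 <= nu j < 1 / 2) ->
  (forall i, i \in (~: J)%SET -> 0 <= nu i) ->
  nubar = \sum_(i in (~: J)%SET) nu i ->
  1 / 2 <= nubar ->
  ('E_P[(fun w => (\prod_(j in J) `|tnth (X w) j| `^ (- 2 * nu j))
                  * \prod_(i in (~: J)%SET) `|tnth (X w) i| `^ (2 * nu i))%R]
   <= 'E_P[(fun w => \prod_(j in J) `|tnth (X w) j| `^ (- 2 * nu j))%R]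
      * 'E_P[(fun w => (\sum_(i in (~: J)%SET) nu i / nubar * `|tnth (X w) i|)
                       `^ (2 * nubar))%R])%E.
Proof.
move=> pS XG _ _ nuJ nuC nuE nub; rewrite !expectation.unlock.
have nub0 : 0 < nubar by apply: lt_le_trans nub; rewrite divr_gt0.
pose f (t : d.-tuple R) := \prod_(j in J) `|tnth t j| `^ (- 2 * nu j).
pose h (t : d.-tuple R) := \prod_(i in (~: J)%SET) `|tnth t i| `^ (2 * nu i).
pose g (t : d.-tuple R) :=
  (\sum_(i in (~: J)%SET) nu i / nubar * `|tnth t i|) `^ (2 * nubar).
have f0 t : 0 <= f t by apply: prodr_ge0 => j _; exact: powR_ge0.
have h0 t : 0 <= h t by apply: prodr_ge0 => j _; exact: powR_ge0.
have g0 t : 0 <= g t by exact: powR_ge0.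
have mf : measurable_fun setT f.
  rewrite (_ : f = fun t => \prod_(j <- enum J) `|tnth t j| `^ (- 2 * nu j)).
    by apply: measurable_prod => j _; exact: measurable_tnth_powR.
  by apply/funext => t; rewrite big_enum.
have mh : measurable_fun setT h.
  rewrite (_ : h = fun t => \prod_(j <- enum (~: J)%SET) `|tnth t j| `^ (2 * nu j)).
    by apply: measurable_prod => j _; exact: measurable_tnth_powR.
  by apply/funext => t; rewrite big_enum.
have mg : measurable_fun setT g.
  apply: (measurableT_comp (measurable_powR _)).
  rewrite (_ : (fun t => _) = fun t : d.-tuple R =>
      \sum_(i <- enum (~: J)%SET) nu i / nubar * `|tnth t i|).
    apply: measurable_sum => i; apply: measurable_funM => //.
    by apply: measurableT_comp => //; exact: measurable_tnth.
  by apply/funext => t; rewrite big_enum.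
have mX : measurable_fun setT X by exact: measurable_funP.
have mXF (F : d.-tuple R -> R) :
    measurable_fun setT F -> measurable_fun setT (fun w => (F (X w))%:E).
  by move=> mF; apply/measurable_EFinP; exact: (measurableT_comp mF).
have mfg : measurable_fun setT (f \* g) by exact: measurable_funM.
have fg0 t : 0 <= (f \* g) t by exact: mulr_ge0.
apply: (@le_trans _ _ (\int[P]_w ((f \* g) (X w))%:E)%E).
  apply: ge0_le_integral => //.
  - by move=> w _; rewrite lee_fin; exact: (mulr_ge0 (f0 _) (h0 _)).
  - by apply: (mXF (f \* h)); exact: measurable_funM.
  - exact: mXF.
  move=> w _; rewrite lee_fin (ler_wpM2l (f0 _))//.
  exact: (weighted_amgm (a := fun i => `|tnth (X w) i|) nuC (fun=> normr_ge0 _) nuE nub0).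
set A := invmx Sigma; set k := (Num.sqrt ((2 * pi) ^+ d * \det Sigma))^-1.
have E F := gaussian_expectation (F := F) XG.
(* The total mass is read off from [P] being a probability; it also forces [k > 0], since [k = 0]
   would give mass 0. *)
have one : (k%:E * \int[lebesgue_tuple R d]_t (gauss_kernel A t)%:E = 1)%E.
  transitivity (\int[P]_w ((fun=> 1 : R) (X w))%:E)%E.
    rewrite [RHS](E (fun=> 1))//; congr (_ * _)%E; apply: eq_integral => t _.
    by rewrite mul1r.
  by rewrite integral_cst//= mul1e probability_setT.
have k0 : 0 < k.
  rewrite lt_neqAle invr_ge0 sqrtr_ge0 andbT; apply/eqP => k0.
  by move: one; rewrite -/k -k0 mul0e => /eqP; rewrite eq_sym onee_eq0.
have Eg0 : (0 <= \int[P]_w (g (X w))%:E)%E.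
  by apply: integral_ge0 => w _; rewrite lee_fin.
have Ef0 : (0 <= \int[P]_w (f (X w))%:E)%E.
  by apply: integral_ge0 => w _; rewrite lee_fin.
rewrite -[leRHS]/((\int[P]_w (f (X w))%:E) * (\int[P]_w (g (X w))%:E))%E.
(* [prod_powR_le] takes a real bound [c], so an infinite mean of [g] is treated apart: the
   right-hand side is then infinite, unless [f] has mean 0, hence vanishes almost surely, and the
   left-hand side is 0 too. *)
have [Egoo|Egfin] := eqVneq (\int[P]_w (g (X w))%:E)%E +oo%E.
  move: Ef0; rewrite le_eqVlt => /predU1P[Ef0|Ef0]; last first.
    by rewrite Egoo gt0_muley// leey.
  rewrite -Ef0 mul0e.
  have f_ae0 : ae_eq P setT (fun w => (f (X w))%:E) (cst 0%E).
    apply/ae_eq_integral_abs => //; first exact: mXF.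
    by rewrite [RHS]Ef0; apply: eq_integral => w _; rewrite gee0_abs// lee_fin.
  rewrite (@ge0_ae_eq_integral _ _ _ P setT _ (cst 0%E)) ?integral0//.
  - exact: mXF.
  - by move=> w _; rewrite lee_fin.
  apply: filterS f_ae0 => w /= fw0 _; move: (fw0 I) => [->].
  by rewrite mul0r.
have [c cE] : exists c, (\int[P]_w (g (X w))%:E)%E = c%:E.
  by exists (fine (\int[P]_w (g (X w))%:E)%E); rewrite fineK// ge0_fin_numE// lt_neqAle Egfin leey.
have c0 : 0 <= c by rewrite -lee_fin -cE.
rewrite cE muleC (E (f \* g))// (E f)// muleCA lee_pmul2l// ?lte_fin//.
(* With [c] the mean of [g], the starting bound for [A] holds with equality. *)
have gA : (\int[lebesgue_tuple R d]_t (g t * gauss_kernel A t)%:E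
    <= c%:E * \int[lebesgue_tuple R d]_t (gauss_kernel A t)%:E)%E.
  rewrite -(@lee_pmul2l _ k%:E)// ?lte_fin// muleCA one mule1 -cE (E g)//.
(* The assumption [nubar >= 1/2] makes the power [2 nubar] convex. *)
have p1 : 1 <= 2 * nubar by lra.
have w0 i : i \in (~: J)%SET -> 0 <= nu i / nubar.
  by move=> iC; rewrite divr_ge0 ?nuC// ltW.
have := @prod_powR_le R d g c mg g0 (fun x y z => convex_norm_powR w0 p1) c0
  (enum J) nu A.
have -> : (fun t => ((\prod_(j <- enum J) `|tnth t j| `^ (-2 * nu j)) * g t *
     gauss_kernel A t)%:E) = fun t => ((f \* g) t * gauss_kernel A t)%:E.
  by apply/funext => t; rewrite big_enum.
have -> : (fun t => ((\prod_(j <- enum J) `|tnth t j| `^ (-2 * nu j)) *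
     gauss_kernel A t)%:E) = fun t => (f t * gauss_kernel A t)%:E.
  by apply/funext => t; rewrite big_enum.
apply => //; last exact: posdefmx_inv.
by move=> j; rewrite mem_enum; exact: nuJ.
Qed.
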